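(* Let $n$ be a non-negative integer and let $\mathbb{P}\{n\}$ denote the discrete combinatorial projective geometry on the set $\underline{n}=\{1,2,\ldots,n\}$. Then the plasma associated to $\mathbb{P}\{n\}$ under the embedding of combinatorial projective geometries into plasmas is (isomorphic to) the $n$-fold coproduct $\bigvee_{n}\mathbb{K}$, in the category of plasmas, of the Krasner hypergroup $\mathbb{K}$ with itself.
   Context: A plasma is a set $X$ with a hyperoperation $\star\colon X\times X\to\mathcal{P}(X)$ (where $\mathcal{P}(X)$ is the power set; the empty value is allowed) and an element $0\in X$ (the weak identity) such that $x\star y=y\star x$ for all $x,y\in X$ and $x\in x\star 0$ for all $x\in X$. A morphism $(X,\star,0)\to(Y,\boxplus,e)$ is a function $f\colon X\to Y$ with $f(0)=e$ and $f(x\star x')\subseteq f(x)\boxplus f(x')$ for all $x,x'\in X$. The Krasner hypergroup $\mathbb{K}$ is the plasma $\{0,1\}$ with weak identity $0$ and $0+0=\{0\}$, $0+1=1+0=\{1\}$, $1+1=\{0,1\}$. A combinatorial projective geometry is a set $G$ with a ternary relation $\ell\subseteq G\times G\times G$ (collinearity) such that: (i) $(a,b,a)\in\ell$ for all $a,b$; (ii) if $(a,p,q),(b,p,q)\in\ell$ and $p\neq q$ then $(a,b,p)\in\ell$; (iii) if $(p,a,b),(p,c,d)\in\ell$ then there is $q\in G$ with $(q,a,c),(q,b,d)\in\ell$. The discrete geometry on a set $G$ has $(x,y,z)\in\ell$ exactly when $|\{x,y,z\}|\le 2$; so every pair of distinct points lies on a unique line and that line contains no other points. The plasma associated to $(G,\ell)$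 has underlying set $G\sqcup\{0\}$, weak identity $0$, and hyperoperation $\boxplus$ given by $0\boxplus 0=\{0\}$; $x\boxplus 0=0\boxplus x=\{x\}$ and $x\boxplus x=\{x,0\}$ for $x\in G$; and $x\boxplus y=\{z\in G:(z,x,y)\in\ell\}\setminus\{x,y\}$ for $x\ne y$ in $G$. *)

(* Defs.v *)
From mathcomp Require Import all_boot.
From mathcomp Require Import boolp classical_sets.

Set Implicit Arguments.
Unset Strict Implicit.
Unset Printing Implicit Defensive.

Local Open Scope classical_set_scope.

Record plasma := Plasma {
  plasma_car :> Type;
  hop : plasma_car -> plasma_car -> set plasma_car;
  wid : plasma_car;
  hopC : forall x y, hop x y = hop y x;
  hop_wid : forall x, hop x wid x }.

Record plasma_hom (X Y : plasma) := PlasmaHom {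
  hom_fun :> X -> Y;
  hom_wid : hom_fun (wid X) = wid Y;
  hom_hop : forall x x' : X,
    hom_fun @` hop x x' `<=` hop (hom_fun x) (hom_fun x') }.

Definition plasma_isomorphic (X Y : plasma) : Prop :=
  exists (f : plasma_hom X Y) (g : plasma_hom Y X), cancel f g /\ cancel g f.

(* The universal property of a coproduct in the category of plasmas.  Leibniz
   equality of morphisms, used by [exists!], is equality of the underlying
   functions, by functional extensionality and proof irrelevance. *)
Definition is_coproduct (I : Type) (A : I -> plasma) (C : plasma)
    (inj : forall i, plasma_hom (A i) C) : Prop :=
  forall (Z : plasma) (f : forall i, plasma_hom (A i) Z),
    exists! h : plasma_hom C Z, forall i (x : A i), h (inj i x) = f i x.

(* [false] is 0 and [true] is 1. *)
Definition krasner_hop (x y : bool) : set bool :=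
  match x, y with
  | false, false => [set false]
  | false, true | true, false => [set true]
  | true, true => [set false; true]
  end.

Lemma krasner_hopC x y : krasner_hop x y = krasner_hop y x.
Proof. by case: x; case: y. Qed.

Lemma krasner_hop_wid x : krasner_hop x false x.
Proof. by case: x. Qed.

Definition krasner : plasma := Plasma krasner_hopC krasner_hop_wid.

Record proj_geometry := ProjGeometry {
  point :> Type;
  collinear : point -> point -> point -> Prop;
  collinear_refl : forall a b, collinear a b a;
  collinear_line : forall a b p q,
    collinear a p q -> collinear b p q -> p <> q -> collinear a b p;
  collinear_veblen : forall p a b c d,
    collinear p a b -> collinear p c d ->
    exists q, collinear q a c /\ collinear q b d }.

Section Discrete.
Variable T : finType.
Implicit Types x y z a b c d p q : T.

Definition discrete_collinear x y z : Prop := (#|[set x; y; z]%SET| <= 2)%N.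

Lemma discrete_collinearP x y z :
  discrete_collinear x y z <-> [\/ x = y, x = z | y = z].
Proof.
rewrite /discrete_collinear finset.setUC cardsU1 cards2 !inE.
have [->|zx] := eqVneq z x; first by split=> _; [exact: Or32|case: eqP].
have [->|zy] := eqVneq z y; first by split=> _; [exact: Or33|case: eqP].
have [->|xy] := eqVneq x y; first by split=> _; [exact: Or31|].
by split=> // -[] e; move: zx zy xy; rewrite e eqxx.
Qed.

Lemma discrete_refl a b : discrete_collinear a b a.
Proof. by apply/discrete_collinearP; exact: Or32. Qed.

Lemma discrete_line a b p q :
  discrete_collinear a p q -> discrete_collinear b p q -> p <> q ->
  discrete_collinear a b p.
Proof.
move=> /discrete_collinearP ha /discrete_collinearP hb pq.
apply/discrete_collinearP.
by case: ha => // ->; case: hb => // ->; constructor.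
Qed.

Lemma discrete_veblen p a b c d :
  discrete_collinear p a b -> discrete_collinear p c d ->
  exists q, discrete_collinear q a c /\ discrete_collinear q b d.
Proof.
move=> /discrete_collinearP hab /discrete_collinearP hcd.
have ex q : [\/ q = a, q = c | a = c] -> [\/ q = b, q = d | b = d] ->
    exists q, discrete_collinear q a c /\ discrete_collinear q b d.
  by move=> h1 h2; exists q; split; apply/discrete_collinearP.
by case: hab => e1; case: hcd => e2; subst;
  (apply: (ex a); by constructor) || (apply: (ex b); by constructor) ||
  (apply: (ex c); by constructor) || (apply: (ex d); by constructor).
Qed.

Definition discrete_geometry : proj_geometry :=
  ProjGeometry discrete_refl discrete_line discrete_veblen.

End Discrete.

Section PlasmaOfGeometry.
Variable G : proj_geometry.

(* The carrier G + {0} is [option G], with [None] as the weak identity. *)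
Definition geometry_hop (u v : option G) : set (option G) :=
  match u, v with
  | None, None => [set None]
  | Some x, None | None, Some x => [set Some x]
  | Some x, Some y =>
      if `[< x = y >] then [set Some x; None]
      else Some @` ([set z | collinear z x y] `\` [set x; y])
  end.

Lemma collinear_swap (x y z : G) : x <> y -> collinear z x y -> collinear z y x.
Proof. by move=> xy zxy; apply: collinear_line zxy _ xy; exact: collinear_refl. Qed.

Lemma geometry_hopC u v : geometry_hop u v = geometry_hop v u.
Proof.
case: u => [x|]; case: v => [y|] //=.
case: asboolP => [->|xy]; first by rewrite asboolT.
rewrite asboolF; last by move=> yx; apply: xy.
congr (_ @` _); rewrite classical_sets.setUC; congr (_ `\` _).
apply/seteqP; split=> z /=; apply: collinear_swap => //.
by move=> yx; apply: xy.
Qed.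

Lemma geometry_hop_wid u : geometry_hop u None u.
Proof. by case: u. Qed.

Definition plasma_of_geometry : plasma := Plasma geometry_hopC geometry_hop_wid.

End PlasmaOfGeometry.

(* Main.v *)
Require Import Defs.
From mathcomp Require Import all_boot.
From mathcomp Require Import boolp classical_sets.

(** A coproduct of pointed objects is a wedge.  The carrier of the plasma of
    a geometry on [T] is [option T], which is the wedge of [T] many copies of
    [{0, 1}] glued at [0], so the pointed maps out of it correspond to
    families of pointed maps out of the copies.  What remains is to see that
    the hyperoperation is the smallest one making the inclusions of the copies
    morphisms: inside one copy it is that of the Krasner hypergroup, and the
    sum of two nonzero elements of different copies has to be empty.  The
    latter is what discreteness gives ([discrete_hop_neq]): a line through two
    distinct points has no third point.  An empty sum puts no condition on a
    map, so the glued map is a morphism as soon as its restrictions are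
    ([discrete_coproduct]). *)

Set Implicit Arguments.
Unset Strict Implicit.
Unset Printing Implicit Defensive.

Local Open Scope classical_set_scope.

(** This is what turns uniqueness in the universal property into a pointwise
    statement: the two other fields of a morphism are proofs. *)
Lemma plasma_hom_eq (X Y : plasma) (f g : plasma_hom X Y) : f =1 g -> f = g.
Proof.
case: f g => [f f0 fS] [g g0 gS] /= /funext fg; rewrite {}fg in f0 fS *.
by congr PlasmaHom; exact: Prop_irrelevance.
Qed.

Lemma plasma_isomorphic_refl (X : plasma) : plasma_isomorphic X X.
Proof.
have idS (x y : X) : id @` hop x y `<=` hop x y by rewrite image_id.
by exists (PlasmaHom (erefl (wid X)) idS), (PlasmaHom (erefl (wid X)) idS).
Qed.

Lemma geometry_hop_self (G : proj_geometry) (x : G) :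
  geometry_hop (Some x) (Some x) = [set Some x; None].
Proof. by rewrite /= asboolT. Qed.

Section PointInclusion.
Variables (G : proj_geometry) (i : G).

Definition point_fun (b : krasner) : plasma_of_geometry G :=
  if b then Some i else None.

(** In every geometry [{0, i}] is a copy of the Krasner hypergroup, since the
    sums [0 + i] and [i + i] do not involve collinearity. *)
Lemma point_fun_hop (b c : krasner) :
  point_fun @` hop b c `<=` hop (point_fun b) (point_fun c).
Proof.
move=> _ [d bcd <-]; case: b c bcd => [] [] /=; try by move=> ->.
by rewrite asboolT // => -[] ->; [right|left].
Qed.

Definition point_hom : plasma_hom krasner (plasma_of_geometry G) :=
  @PlasmaHom krasner (plasma_of_geometry G) point_fun erefl point_fun_hop.

End PointInclusion.

Section DiscreteCoproduct.
Variable T : finType.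

Local Notation PT := (plasma_of_geometry (discrete_geometry T)).

(** The sum of two distinct points consists of the other points of the line
    through them, and a discrete line has only two points. *)
Lemma discrete_hop_neq (x y : T) :
  x <> y -> @hop PT (Some x) (Some y) = set0.
Proof.
move=> xy; rewrite /= asboolF //; apply/seteqP; split=> // w [z [+ zxy] _].
by move=> /discrete_collinearP[zx|zy|//]; apply: zxy; [left|right].
Qed.

Section CopairHom.
Variables (Z : plasma) (f : T -> plasma_hom krasner Z).

Definition copair_fun (u : PT) : Z :=
  if u is Some i then f i true else wid Z.

(** Two nonzero elements with a nonempty sum lie in the same copy, where [f]
    is known to be a morphism; a sum with [0] is handled by the weak identity
    of [Z]. *)
Lemma copair_fun_hop (u v : PT) :
  copair_fun @` hop u v `<=` hop (copair_fun u) (copair_fun v).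
Proof.
move=> _ [w uvw <-]; case: u v uvw => [x|] [y|].
- have [<-|xy] := pselect (x = y); last by rewrite discrete_hop_neq.
  (* both values of [x + x] come from [1 + 1 = {0, 1}] in the copy at [x] *)
  rewrite [hop _ _]geometry_hop_self => -[] -> /=; apply: (hom_hop (p := f x)).
    by exists true => //; right.
  by exists false; [left|exact: hom_wid].
- by move=> /= ->; exact: hop_wid.
- by move=> /= ->; rewrite hopC; exact: hop_wid.
- by move=> /= ->; exact: hop_wid.
Qed.

Definition copair_hom : plasma_hom PT Z :=
  @PlasmaHom PT Z copair_fun erefl copair_fun_hop.

End CopairHom.

(** Every element of the carrier is the image of [0] or of some [1] under an
    inclusion, so a morphism is determined by its restrictions; this holds
    for empty [T] too, because [0] has to go to [0]. *)
Lemma discrete_coproduct :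
  is_coproduct (@point_hom (discrete_geometry T)).
Proof.
move=> Z f; exists (copair_hom f); split.
  by move=> i [|] //=; rewrite (hom_wid (f i)).
move=> h hf; apply: plasma_hom_eq => -[i|] /=.
  by rewrite -(hf i true).
by rewrite (hom_wid h).
Qed.

End DiscreteCoproduct.

Theorem theorem3p1 (n : nat) :
  exists (C : plasma) (inj : forall i : 'I_n, plasma_hom krasner C),
    is_coproduct inj /\
    plasma_isomorphic (plasma_of_geometry (discrete_geometry 'I_n)) C.
Proof.
exists (plasma_of_geometry (discrete_geometry 'I_n)).
exists (@point_hom (discrete_geometry 'I_n)).
by split; [exact: discrete_coproduct|exact: plasma_isomorphic_refl].
Qed.
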